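(* Let $G=(V,E)$, $J_{x,y}$, $h_x$, $H$, $\mathrm{GS}$, $P^{\mathrm{SCA}}_{\beta,\boldsymbol q}$, $\pi^{\mathrm{SCA}}_{\beta,\boldsymbol q}$, $\pi^{\mathrm G}_\infty$ and $\delta(\cdot)$ be as defined in the context. Let $\lambda$ be the largest eigenvalue of the matrix $[-J_{x,y}]_{V\times V}$, let $C\subset V$ be an arbitrary subset, and suppose that the pinning parameters $\boldsymbol q=\{q_x\}_{x\in V}$ satisfy $$q_x\ge\begin{cases}\displaystyle\sum_{y\in V}|J_{x,y}|-\frac12\sum_{y\in C}|J_{x,y}| & \text{if }x\in C,\\[1ex] \displaystyle\frac{\lambda}{2} & \text{if }x\notin C.\end{cases}$$ (1) For any non-decreasing sequence $\{\beta_t\}_{t\in\mathbb N}$ of non-negative real numbers with $\lim_{t\to\infty}\beta_t=\infty$, $$\sum_{t=1}^\infty\big\|\pi^{\mathrm{SCA}}_{\beta_{t+1},\boldsymbol q}-\pi^{\mathrm{SCA}}_{\beta_t,\boldsymbol q}\big\|_{\mathrm{TV}}<\infty\qquad\text{and}\qquad\lim_{t\to\infty}\big\|\pi^{\mathrm{SCA}}_{\beta_t,\boldsymbol q}-\pi^{\mathrm G}_\infty\big\|_{\mathrm{TV}}=0 .$$ (2) In particular, if $\{\beta_t\}_{t\in\mathbb N}$ is chosen as $$\beta_t=\frac{\log t}{\Gamma},\qquad \Gamma=\sum_{x\in V}\Gamma_x,\qquad \Gamma_x=q_x+|h_x|+\sum_{y\in V}|J_{x,y}|$$ (where $\Gamma>0$),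 then $$\sum_{t=1}^\infty\big(1-\delta(P^{\mathrm{SCA}}_{\beta_t,\boldsymbol q})\big)=\infty ,$$ and, as a result, for any initial time $j\in\mathbb N$, $$\lim_{t\to\infty}\sup_\mu\big\|\mu P^{\mathrm{SCA}}_{\beta_j,\boldsymbol q}P^{\mathrm{SCA}}_{\beta_{j+1},\boldsymbol q}\cdots P^{\mathrm{SCA}}_{\beta_t,\boldsymbol q}-\pi^{\mathrm G}_\infty\big\|_{\mathrm{TV}}=0 ,$$ where the supremum is over all probability distributions $\mu$ on $\Omega$.
   Context: $G=(V,E)$ is a finite graph with nonempty vertex set and no multi- or self-edges. $\{J_{x,y}\}_{x,y\in V}$ are real spin-spin coupling constants with $J_{x,y}=J_{y,x}$ for all $x,y$ and $J_{x,y}=0$ whenever $\{x,y\}\notin E$ (in particular $J_{x,x}=0$). $\{h_x\}_{x\in V}$ are real external fields. The configuration space is $\Omega=\{\pm1\}^V$, and the Ising Hamiltonian is $$H(\boldsymbol\sigma)=-\frac12\sum_{x,y\in V}J_{x,y}\sigma_x\sigma_y-\sum_{x\in V}h_x\sigma_x,\qquad\boldsymbol\sigma=\{\sigma_x\}_{x\in V}\in\Omega .$$ The set of ground states is $\mathrm{GS}=\{\boldsymbol\sigma\in\Omega:H(\boldsymbol\sigma)=\min_{\boldsymbol\tau\in\Omega}H(\boldsymbol\tau)\}$, and $\pi^{\mathrm G}_\infty$ denotes the uniform distribution over $\mathrm{GS}$, i.e. $\pi^{\mathrm G}_\infty(\boldsymbol\sigma)=1/|\mathrm{GS}|$ if $\boldsymbol\sigma\in\mathrm{GS}$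 and $0$ otherwise. For real pinning parameters $\boldsymbol q=\{q_x\}_{x\in V}$, set $$\tilde H(\boldsymbol\sigma,\boldsymbol\tau)=-\frac12\sum_{x,y\in V}J_{x,y}\sigma_x\tau_y-\frac12\sum_{x\in V}h_x(\sigma_x+\tau_x)-\frac12\sum_{x\in V}q_x\sigma_x\tau_x ,$$ and, for inverse temperature $\beta\ge0$, $w^{\mathrm{SCA}}_{\beta,\boldsymbol q}(\boldsymbol\sigma)=\sum_{\boldsymbol\tau\in\Omega}e^{-\beta\tilde H(\boldsymbol\sigma,\boldsymbol\tau)}$. The transition matrix of the stochastic cellular automaton (SCA) is $$P^{\mathrm{SCA}}_{\beta,\boldsymbol q}(\boldsymbol\sigma,\boldsymbol\tau)=\frac{e^{-\beta\tilde H(\boldsymbol\sigma,\boldsymbol\tau)}}{w^{\mathrm{SCA}}_{\beta,\boldsymbol q}(\boldsymbol\sigma)} ,$$ with equilibrium distribution $$\pi^{\mathrm{SCA}}_{\beta,\boldsymbol q}(\boldsymbol\sigma)=\frac{w^{\mathrm{SCA}}_{\beta,\boldsymbol q}(\boldsymbol\sigma)}{\sum_{\boldsymbol\tau\in\Omega}w^{\mathrm{SCA}}_{\beta,\boldsymbol q}(\boldsymbol\tau)} .$$ The total-variation distance of probability measures on $\Omega$ is $\|\mu-\nu\|_{\mathrm{TV}}=\frac12\sum_{\boldsymbol\sigma\in\Omega}|\mu(\boldsymbol\sigma)-\nu(\boldsymbol\sigma)|$. For a transition matrix $P$ on $\Omega$, Dobrushin's ergodic coefficient is $$\delta(P)=\max_{\boldsymbol\sigma,\boldsymbol\tau\in\Omega}\|P(\boldsymbol\sigma,\cdot)-P(\boldsymbol\tau,\cdot)\|_{\mathrm{TV}}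 .$$ For a probability distribution $\mu$ on $\Omega$, $(\mu P)(\boldsymbol\tau)=\sum_{\boldsymbol\sigma}\mu(\boldsymbol\sigma)P(\boldsymbol\sigma,\boldsymbol\tau)$. Here $\mathbb N=\{1,2,3,\dots\}$. *)

(* Defs.v *)
From HB Require Import structures.
From mathcomp Require Import all_boot all_order all_algebra.
From mathcomp Require Import all_classical all_reals all_analysis.

Set Implicit Arguments.
Unset Strict Implicit.
Unset Printing Implicit Defensive.

Import Order.TTheory GRing.Theory Num.Theory.
Import numFieldNormedType.Exports.

Local Open Scope ring_scope.

(* {-1, +1}^V, with the two spin values encoded by bool and read through
   [spin]. *)
Definition config (V : finType) := {ffun V -> bool}.

Definition spin (R : realType) (b : bool) : R := if b then 1 else -1.

Section Ising.
Variables (R : realType) (V : finType).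
Variables (J : V -> V -> R) (h : V -> R).

Definition hamiltonian (s : config V) : R :=
  - (2^-1 * \sum_x \sum_y J x y * spin R (s x) * spin R (s y))
  - \sum_x h x * spin R (s x).

Definition ground_states : {set config V} :=
  [set s | [forall t, hamiltonian s <= hamiltonian t]].

Definition pi_ground (s : config V) : R :=
  if s \in ground_states then #|ground_states|%:R^-1 else 0.

(* Matrices are indexed by ordinals, so V is enumerated by [enum_val]; the
   spectrum does not depend on the enumeration. *)
Definition neg_coupling_mx : 'M[R]_#|V| :=
  \matrix_(i, j) - J (enum_val i) (enum_val j).

Variable q : V -> R.

Definition sca_hamiltonian (s t : config V) : R :=
  - (2^-1 * \sum_x \sum_y J x y * spin R (s x) * spin R (t y))
  - 2^-1 * (\sum_x h x * (spin R (s x) + spin R (t x)))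
  - 2^-1 * (\sum_x q x * spin R (s x) * spin R (t x)).

Definition sca_weight (beta : R) (s : config V) : R :=
  \sum_(t : config V) expR (- (beta * sca_hamiltonian s t)).

Definition sca_trans (beta : R) (s t : config V) : R :=
  expR (- (beta * sca_hamiltonian s t)) / sca_weight beta s.

Definition sca_equilibrium (beta : R) (s : config V) : R :=
  sca_weight beta s / \sum_(t : config V) sca_weight beta t.

Definition Gamma_site (x : V) : R := q x + `|h x| + \sum_y `|J x y|.

Definition Gamma : R := \sum_x Gamma_site x.

End Ising.

Definition largest_eigenvalue (R : realType) (n : nat) (A : 'M[R]_n)
    (lam : R) : Prop :=
  eigenvalue A lam /\ forall a : R, eigenvalue A a -> a <= lam.

Section FiniteChains.
Variables (R : realType) (T : finType).

Definition is_distribution (mu : T -> R) : Prop :=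
  (forall s, 0 <= mu s) /\ \sum_s mu s = 1.

Definition tv_dist (mu nu : T -> R) : R :=
  2^-1 * \sum_s `|mu s - nu s|.

(* The default value 0 of the maxima is harmless: [tv_dist] is nonnegative. *)
Definition dobrushin (P : T -> T -> R) : R :=
  \big[Num.max/0]_(s : T) \big[Num.max/0]_(t : T) tv_dist (P s) (P t).

Definition dist_step (mu : T -> R) (P : T -> T -> R) : T -> R :=
  fun t => \sum_s mu s * P s t.

(* mu P_j P_(j+1) ... P_t; this is mu itself when t < j. *)
Definition dist_evolve (P : nat -> T -> T -> R) (mu : T -> R) (j t : nat) :
    T -> R :=
  foldl (fun nu k => dist_step nu (P k)) mu (index_iota j t.+1).

End FiniteChains.

(* Main.v *)
(** Write [a = (s + t) / 2] and [b = (s - t) / 2] for two spin configurations.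
    Up to a constant the pair energy of [(s, t)] is [F a + (b J b / 2 + q b^2)],
    where [F] is the multi-affine extension of the Ising energy to real spins.
    Rounding the zero coordinates of [a] one at a time gives [F a >= min H]; the
    second term is nonnegative by the condition on [q] (row sums inside [C],
    Rayleigh quotient outside).  In case of equality every site where [s] and
    [t] differ has [J x _ = 0], [h x = 0], [q x = 0], so all ground states have
    the same number of minimizing partners and the limit is uniform even when
    the condition on [q] is tight.

    Measuring energies from the minimum, the equilibrium is [A s / Z] with [A s]
    and [Z >= 1] nonincreasing in [beta], so its variation telescopes.

    For [beta_t = log t / Gamma] every transition probability is at least
    [1 / (t |Omega|)].  Each step thus contracts total variation by [1 - 1/t],
    and these factors telescope. *)

Require Import Defs.
From HB Require Import structures.
From mathcomp Require Import all_boot all_order all_algebra.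
From mathcomp Require Import all_classical all_reals all_analysis.
From mathcomp Require Import ring lra.

Set Implicit Arguments.
Unset Strict Implicit.
Unset Printing Implicit Defensive.

Import Order.TTheory GRing.Theory Num.Theory.
Import numFieldNormedType.Exports.

Local Open Scope classical_set_scope.
Local Open Scope ring_scope.

(** * Rayleigh quotient *)

Definition dotmx (R : realType) (n : nat) (u v : 'rV[R]_n) : R :=
  \sum_i u 0 i * v 0 i.

Lemma dotmxC (R : realType) (n : nat) (u v : 'rV[R]_n) :
  dotmx u v = dotmx v u.
Proof. by apply: eq_bigr => i _; rewrite mulrC. Qed.

Lemma dotmxDl (R : realType) (n : nat) (a : R) (u v w : 'rV[R]_n) :
  dotmx (a *: u + v) w = a * dotmx u w + dotmx v w.
Proof.
rewrite /dotmx mulr_sumr -big_split; apply: eq_bigr => i _ /=.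
by rewrite !mxE mulrDl mulrA.
Qed.

Lemma dotmx_ge0 (R : realType) (n : nat) (u : 'rV[R]_n) : 0 <= dotmx u u.
Proof. by apply: sumr_ge0 => i _; rewrite -expr2 sqr_ge0. Qed.

Lemma dotmx_eq0 (R : realType) (n : nat) (u : 'rV[R]_n) :
  (dotmx u u == 0) = (u == 0).
Proof.
rewrite /dotmx psumr_eq0 => [|i _]; last by rewrite -expr2 sqr_ge0.
apply/allP/eqP => [u0|-> i _]; last by rewrite /= mxE mul0r.
apply/rowP => i; rewrite mxE.
by have := u0 i (mem_index_enum i); rewrite /= -expr2 sqrf_eq0 => /eqP.
Qed.

Lemma dotmx_mulr (R : realType) (n : nat) (A : 'M[R]_n) (u v : 'rV[R]_n) :
  dotmx (u *m A) v = dotmx u (v *m A^T).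
Proof.
rewrite /dotmx; under eq_bigr do rewrite mxE mulr_suml.
rewrite exchange_big; apply: eq_bigr => i _ /=.
rewrite mxE mulr_sumr; apply: eq_bigr => j _; rewrite mxE; ring.
Qed.

Lemma cvg_sumr (R : realType) (T : Type) (F : set_system T) (I : Type)
    (r : seq I) (f : I -> T -> R) (l : I -> R) :
  Filter F -> (forall i, f i x @[x --> F] --> l i) ->
  \sum_(i <- r) f i x @[x --> F] --> \sum_(i <- r) l i.
Proof.
move=> FF fl; elim: r => [|i r IHr].
  by rewrite big_nil; under eq_cvg do rewrite big_nil; exact: cvg_cst.
by rewrite big_cons; under eq_cvg do rewrite big_cons; exact: cvgD.
Qed.

Lemma dotmx_continuous (R : realType) (n : nat) (A : 'M[R]_n) :
  continuous (fun u : 'rV[R]_n => dotmx (u *m A) u).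
Proof.
move=> u; rewrite /continuous_at; apply: (@cvg_sumr R _ (nbhs u)) => i.
apply: cvgM; last exact: coord_continuous.
rewrite mxE; under eq_cvg do rewrite mxE.
apply: (@cvg_sumr R _ (nbhs u)) => j.
by apply: cvgM; [exact: coord_continuous|exact: cvg_cst].
Qed.

(** The matrix norm is the largest absolute entry, and each squared entry is at most the whole sum,
    so the sphere is bounded; it is closed as a preimage of [1]. *)
Lemma unit_sphere_compact (R : realType) (n : nat) :
  compact [set u : 'rV[R]_n.+1 | dotmx u u = 1].
Proof.
apply: bounded_closed_compact.
  exists 1; split; first exact: num_real.
  move=> M M1 u /= u1; rewrite [`|u|]mx_normrE; apply: bigmax_le => [|[i j] _] /=.
    by rewrite ltW// (lt_trans ltr01).
  rewrite (le_trans _ (ltW M1))// ord1 -(@expr_le1 _ 2)// real_normK ?num_real//.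
  rewrite -u1 /dotmx (bigD1 j)//= -expr2 lerDl.
  by apply: sumr_ge0 => k _; rewrite -expr2 sqr_ge0.
apply: (@preimage_closed _ R^o (fun u : 'rV[R]_n.+1 => dotmx u u) [set 1]).
  move=> u _; have := @dotmx_continuous R n.+1 1%:M u.
  rewrite (_ : (fun v => _) = fun v : 'rV[R]_n.+1 => dotmx v v); last first.
    by apply/funext => v; rewrite mulmx1.
  exact.
exact: closed_eq.
Qed.

Lemma quadratic_ge0_lin0 (R : realFieldType) (a b : R) :
  (forall e, 0 <= a * e + b * e ^+ 2) -> a = 0.
Proof.
move=> ab_ge0; apply/eqP; rewrite -sqrf_eq0 eq_le sqr_ge0 andbT.
have b_ge0 : 0 <= b by have := ab_ge0 1; have := ab_ge0 (-1); lra.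
have b1_gt0 : 0 < b + 1 by rewrite ltr_pwDr.
(* Here the quadratic equals [- a ^+ 2 / (b + 1) ^+ 2]; the [+ 1] keeps the denominator positive
   when [b = 0]. *)
have := ab_ge0 (- a / (b + 1)).
have -> : a * (- a / (b + 1)) + b * (- a / (b + 1)) ^+ 2 =
    - a ^+ 2 / (b + 1) ^+ 2 by field; rewrite gt_eqF.
by rewrite pmulr_lge0 ?invr_gt0 ?exprn_gt0// oppr_ge0.
Qed.

(** The quadratic form attains its maximum [m] on the compact unit sphere, at some [c]. The
    first-order condition makes [c] an eigenvector for [m], so [m <= lam], and homogeneity does the
    rest. *)
Lemma rayleigh (R : realType) (n : nat) (A : 'M[R]_n) (lam : R)
    (u : 'rV[R]_n) :
  A^T = A -> largest_eigenvalue A lam -> dotmx (u *m A) u <= lam * dotmx u u.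
Proof.
move=> A_sym [_ lam_max].
case: n A u A_sym lam_max => [|n] A u A_sym lam_max.
  by rewrite /dotmx !big_ord0 mulr0.
have [->|u0] := eqVneq u 0.
  by rewrite mul0mx /dotmx !big1 ?mulr0// => i _; rewrite mxE mul0r.
pose S := [set u : 'rV[R]_n.+1 | dotmx u u = 1].
have Sscale v : v != 0 -> S ((Num.sqrt (dotmx v v))^-1 *: v).
  move=> v0; rewrite /S /=.
  have -> : dotmx ((Num.sqrt (dotmx v v))^-1 *: v)
      ((Num.sqrt (dotmx v v))^-1 *: v) =
      (Num.sqrt (dotmx v v))^-1 ^+ 2 * dotmx v v.
    rewrite {1}/dotmx mulr_sumr; apply: eq_bigr => i _.
    by rewrite !mxE; ring.
  by rewrite exprVn sqr_sqrtr ?dotmx_ge0// mulVf// dotmx_eq0.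
have [|||c cS cmax] :=
  @compact_EVT_max _ R (fun v : 'rV[R]_n.+1 => dotmx (v *m A) v) S.
- by exists ((Num.sqrt (dotmx u u))^-1 *: u); exact: Sscale.
- exact: unit_sphere_compact.
- by apply: continuous_subspaceT; exact: dotmx_continuous.
rewrite inE /S /= in cS.
set m := dotmx (c *m A) c in cmax.
have quad_le v : dotmx (v *m A) v <= m * dotmx v v.
  have [->|v0] := eqVneq v 0.
    by rewrite mul0mx /dotmx !big1 ?mulr0// => i _; rewrite mxE mul0r.
  have /mem_set/cmax := Sscale _ v0.
  have -> : dotmx ((Num.sqrt (dotmx v v))^-1 *: v *m A)
      ((Num.sqrt (dotmx v v))^-1 *: v) = dotmx (v *m A) v / dotmx v v.
    rewrite -scalemxAl -[in RHS](sqr_sqrtr (dotmx_ge0 v)) -exprVn.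
    by rewrite {1 3}/dotmx mulr_suml; apply: eq_bigr => i _; rewrite !mxE; ring.
  by rewrite ler_pdivrMr// lt_neqAle eq_sym dotmx_eq0 v0 dotmx_ge0.
(* [w] is half the gradient at [c] of the nonnegative form [Q v = m |v|^2 - v A v]. Since [Q c = 0],
   along [e *: w + c] only [2 |w|^2 e + Q w e^2] remains, which forces [w = 0]. *)
pose w := m *: c - c *m A.
suff /eqP w0 : w == 0.
  have : eigenvalue A m.
    apply/eigenvalueP; exists c; first by apply/esym/eqP; rewrite -subr_eq0 -/w w0.
    by rewrite -dotmx_eq0 cS oner_neq0.
  by move=> /lam_max m_lam; rewrite (le_trans (quad_le u))// ler_wpM2r ?dotmx_ge0.
have wE v : dotmx w v = m * dotmx c v - dotmx (c *m A) v.
  rewrite /dotmx mulr_sumr -sumrB; apply: eq_bigr => i _.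
  by rewrite !mxE mulrBl mulrA.
rewrite -dotmx_eq0; apply/eqP.
pose Q v := m * dotmx v v - dotmx (v *m A) v.
suff /quadratic_ge0_lin0/eqP : forall e, 0 <= 2 * dotmx w w * e + Q w * e ^+ 2.
  by rewrite mulf_eq0 pnatr_eq0 => /eqP.
clearbody w => e; have := quad_le (e *: w + c).
rewrite -subr_ge0 /Q => /le_trans; apply.
rewrite mulmxDl -scalemxAl !dotmxDl ![dotmx _ (e *: w + c)]dotmxC !dotmxDl.
have -> : dotmx w (w *m A) = dotmx (w *m A) w by rewrite dotmxC.
have -> : dotmx c (w *m A) = dotmx w (c *m A).
  by rewrite dotmxC dotmx_mulr A_sym.
rewrite -[dotmx c (c *m A)]dotmxC -/m cS [dotmx c w]dotmxC.
have := wE w; have := wE c; rewrite cS -/m [dotmx c w]dotmxC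
  [dotmx (c *m A) w]dotmxC mulr1 subrr => -> ->; lra.
Qed.

(** * Relaxation of the Ising energy to real spins *)

Section Relaxation.
Variables (R : realType) (V : finType) (J : V -> V -> R) (h : V -> R).
Hypothesis J_sym : forall x y, J x y = J y x.
Hypothesis J_diag : forall x, J x x = 0.

Definition coupling (u v : V -> R) : R := \sum_x \sum_y J x y * u x * v y.

Definition site (x y : V) : R := (y == x)%:R.

Definition shift (u : V -> R) (e : R) (v : V -> R) (x : V) : R :=
  u x + e * v x.

Definition relaxed_energy (u : V -> R) : R :=
  - (2^-1 * coupling u u) - \sum_x h x * u x.

Definition local_field (u : V -> R) (x : V) : R := \sum_y J x y * u y + h x.

(** These are the values taken by half-sums and half-differences of two spins. *)
Definition sign_or_zero (u : V -> R) : Prop :=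
  forall x, [\/ u x = 0, u x = 1 | u x = -1].

Lemma couplingC u v : coupling u v = coupling v u.
Proof.
rewrite /coupling exchange_big; apply: eq_bigr => x _; apply: eq_bigr => y _.
by rewrite J_sym mulrAC.
Qed.

Lemma coupling_shiftl u e v w :
  coupling (shift u e v) w = coupling u w + e * coupling v w.
Proof.
rewrite /coupling mulr_sumr -big_split; apply: eq_bigr => x _ /=.
rewrite mulr_sumr -big_split; apply: eq_bigr => y _ /=; rewrite /shift; ring.
Qed.

Lemma coupling_shift u e v : coupling (shift u e v) (shift u e v) =
  coupling u u + 2 * e * coupling u v + e ^+ 2 * coupling v v.
Proof.
rewrite coupling_shiftl couplingC coupling_shiftl.
rewrite [coupling v (shift _ _ _)]couplingC.
rewrite coupling_shiftl [coupling v u]couplingC; ring.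
Qed.

Lemma sum_site (f : V -> R) x : \sum_y f y * site x y = f x.
Proof.
rewrite (bigD1 x)//= /site eqxx mulr1 big1 ?addr0// => y /negPf ->.
by rewrite mulr0.
Qed.

Lemma coupling_site u x : coupling u (site x) = \sum_y J x y * u y.
Proof.
rewrite /coupling; apply: eq_bigr => y _.
by rewrite (sum_site (fun z => J y z * u y)) J_sym.
Qed.

Lemma coupling_site2 x y : coupling (site y) (site x) = J x y.
Proof. by rewrite coupling_site sum_site. Qed.

(** The coefficient of [e ^+ 2] is a multiple of [J x x = 0], so the energy is affine along a
    coordinate, with slope minus the local field. *)
Lemma relaxed_energy_shift u e x :
  relaxed_energy (shift u e (site x)) =
  relaxed_energy u - e * local_field u x.
Proof.
rewrite /relaxed_energy coupling_shift coupling_site2 J_diag coupling_site.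
have -> : \sum_y h y * shift u e (site x) y = \sum_y h y * u y + e * h x.
  rewrite -(sum_site h x) mulr_sumr -big_split.
  by apply: eq_bigr => y _ /=; rewrite /shift; ring.
by rewrite /local_field; field.
Qed.

Lemma sign_or_zero_shift u e x :
  sign_or_zero u -> u x = 0 -> e = 1 \/ e = -1 ->
  sign_or_zero (shift u e (site x)).
Proof.
move=> u01 ux e1 y; rewrite /shift /site; have [->|_] := eqVneq y x.
  rewrite ux add0r mulr1.
  by case: e1 => ->; [constructor 2|constructor 3].
by rewrite mulr0 addr0.
Qed.

Lemma eq_coupling u u' v v' :
  u =1 u' -> v =1 v' -> coupling u v = coupling u' v'.
Proof.
by move=> uu' vv'; apply: eq_bigr => x _; apply: eq_bigr => y _; rewrite uu' vv'.
Qed.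

(* The energy is affine in each coordinate since J has zero diagonal, so a
   zero coordinate can be rounded to one of the two signs without increasing
   the energy. *)
Lemma relaxed_energy_ge m u :
  (forall s, m <= hamiltonian J h s) -> sign_or_zero u ->
  m <= relaxed_energy u.
Proof.
move=> m_le; have [k] := ubnP #|[set x | u x == 0]%SET|.
elim: k u => // k IHk u u_k u01.
have [u_neq0|[x]] := set_0Vmem [set x | u x == 0]%SET.
  suff -> : relaxed_energy u = hamiltonian J h [ffun x => u x == 1] by [].
  have uE : u =1 (fun x => spin R ([ffun x => u x == 1] x)).
    move=> x; rewrite ffunE /spin; have := u01 x.
    have := finset.in_set0 x; rewrite -u_neq0 inE => /eqP.
    by case: eqP => // ux1 ux0 [].
  rewrite /relaxed_energy (eq_coupling uE uE); congr (_ - _).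
  by apply: eq_bigr => x _; rewrite {1}uE.
rewrite inE => /eqP ux.
have round e : e = 1 \/ e = -1 ->
    m <= relaxed_energy u - e * local_field u x.
  move=> e1; rewrite -relaxed_energy_shift; apply: IHk; last first.
    exact: sign_or_zero_shift.
  rewrite ltnS in u_k; apply: leq_trans u_k; apply: proper_card.
  apply/properP; split.
    apply/fintype.subsetP => y; rewrite !finset.in_set /shift /site.
    have [->|_] := eqVneq y x; first by rewrite ux.
    by rewrite mulr0 addr0.
  exists x; rewrite !finset.in_set ?ux// /shift /site eqxx ux add0r mulr1.
  by case: e1 => ->; rewrite ?oppr_eq0 oner_eq0.
by have := round 1 (or_introl erefl); have := round (-1) (or_intror erefl); lra.
Qed.

(** Rounding [x] to either sign changes the energy by opposite amounts, and at the minimum neither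
    change can be negative. *)
Lemma local_field_eq0 m u x :
  (forall s, m <= hamiltonian J h s) -> sign_or_zero u ->
  relaxed_energy u = m -> u x = 0 -> local_field u x = 0.
Proof.
move=> m_le u01 um ux.
have shift_ge e : e = 1 \/ e = -1 -> m <= m - e * local_field u x.
  move=> e1; rewrite -{2}um -relaxed_energy_shift.
  by apply: relaxed_energy_ge => //; exact: sign_or_zero_shift.
have := shift_ge 1 (or_introl erefl); have := shift_ge (-1) (or_intror erefl).
by move=> ? ?; apply/eqP; rewrite eq_le; apply/andP; split; lra.
Qed.

(** Rounding [x] to [1] keeps the energy minimal and leaves [y] at zero. The local field at [y] thus
    vanishes before and after, and the two values differ by [J x y]. *)
Lemma minimal_coupling_eq0 m u x y :
  (forall s, m <= hamiltonian J h s) -> sign_or_zero u ->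
  relaxed_energy u = m -> u x = 0 -> u y = 0 -> J x y = 0.
Proof.
move=> m_le u01 um ux uy; have [->|xy] := eqVneq x y; first exact: J_diag.
have fx := local_field_eq0 m_le u01 um ux.
have fy := local_field_eq0 m_le u01 um uy.
have v01 := sign_or_zero_shift u01 ux (or_introl erefl).
have vm : relaxed_energy (shift u 1 (site x)) = m.
  by rewrite relaxed_energy_shift fx mulr0 subr0.
have vy : shift u 1 (site x) y = 0.
  by rewrite /shift /site uy eq_sym (negPf xy) mulr0 addr0.
have := local_field_eq0 m_le v01 vm vy.
rewrite /local_field -coupling_site coupling_shiftl mul1r coupling_site2.
by rewrite coupling_site addrAC -/(local_field u y) fy add0r J_sym.
Qed.

End Relaxation.

Lemma eigenvalue_coupling (R : realType) (V : finType) (J : V -> V -> R) lam u :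
  (forall x y, J x y = J y x) -> largest_eigenvalue (neg_coupling_mx J) lam ->
  - coupling J u u <= lam * \sum_x u x ^+ 2.
Proof.
move=> J_sym lamP.
pose v : 'rV[R]_#|V| := \row_i u (enum_val i).
have -> : \sum_x u x ^+ 2 = dotmx v v.
  rewrite big_enum_val; apply: eq_bigr => i _.
  by rewrite !mxE expr2.
have -> : - coupling J u u = dotmx (v *m neg_coupling_mx J) v.
  rewrite /dotmx /coupling big_enum_val -sumrN; apply: eq_bigr => i _ /=.
  rewrite mxE big_enum_val -sumrN mulr_suml; apply: eq_bigr => j _.
  by rewrite !mxE J_sym; ring.
apply: rayleigh lamP; apply/matrixP => i j.
by rewrite !mxE J_sym.
Qed.

(** * Minimizers of the pair energy *)

Section Pinning.
Variables (R : realType) (V : finType) (J : V -> V -> R) (h q : V -> R).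
Variables (lam : R) (C : {set V}).
Hypothesis J_sym : forall x y, J x y = J y x.
Hypothesis J_diag : forall x, J x x = 0.
Hypothesis lamP : largest_eigenvalue (neg_coupling_mx J) lam.
Hypothesis q_in : forall x, x \in C ->
  \sum_y `|J x y| - 2^-1 * \sum_(y in C) `|J x y| <= q x.
Hypothesis q_out : forall x, x \notin C -> lam / 2 <= q x.

Local Notation in_C x := ((x \in C)%:R : R).

(** The spectral bound is tested at a coordinate vector, where the form is [- J x x = 0]; the
    argument [x] witnesses that [V] is nonempty. *)
Lemma eigenvalue_ge0 (x : V) : 0 <= lam.
Proof.
have := eigenvalue_coupling (site R x) J_sym lamP.
rewrite coupling_site2// J_diag oppr0.
have -> : \sum_y site R x y ^+ 2 = 1.
  by rewrite -[RHS](@sum_site R V (fun=> 1) x); apply: eq_bigr => y _;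
    rewrite /site; case: eqP; rewrite ?expr1n ?expr0n ?mulr1 ?mulr0.
by rewrite mulr1.
Qed.

(** The bound inside [C] becomes a row sum with weight 1/2 on [C] and 1 elsewhere. Positivity of the
    weights matters in the equality case. *)
Lemma row_sum_inE x : \sum_y `|J x y| - 2^-1 * \sum_(y in C) `|J x y| =
  \sum_y `|J x y| * (1 - 2^-1 * in_C y).
Proof.
rewrite (big_mkcond (fun y => y \in C)) mulr_sumr -sumrB.
by apply: eq_bigr => y _; case: ifP => _ /=; ring.
Qed.

Lemma in_C_weight_gt0 y : 0 < 1 - 2^-1 * in_C y.
Proof. by case: (y \in C) => /=; rewrite ?mulr1 ?mulr0; lra. Qed.

Lemma pinning_ge0 x : 0 <= q x.
Proof.
have [/q_in|/q_out] := boolP (x \in C); last first.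
  by apply: le_trans; rewrite divr_ge0// (eigenvalue_ge0 x).
apply: le_trans; rewrite row_sum_inE; apply: sumr_ge0 => y _.
by rewrite mulr_ge0// ltW// in_C_weight_gt0.
Qed.

(** The part of the pair energy carried by the half-difference [b]. *)
Definition pinned_form (b : V -> R) : R :=
  2^-1 * coupling J b b + \sum_x q x * b x ^+ 2.

(* Inside [C] the coupling is absorbed by row sums, outside [C] by the
   spectral bound; the cross terms are charged to the sites of [C]. *)
Lemma pinned_form_ge0 b : sign_or_zero b -> 0 <= pinned_form b.
Proof.
move=> b01; pose b1 x := in_C x * b x; pose b2 x := (1 - in_C x) * b x.
have bE : b =1 shift b1 1 b2.
  by move=> x; rewrite /shift /b1 /b2; ring.
rewrite /pinned_form (eq_coupling _ bE bE) coupling_shift//.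
have outer : - 2^-1 * coupling J b2 b2 <= \sum_x q x * b2 x ^+ 2.
  have := eigenvalue_coupling b2 J_sym lamP.
  suff : lam / 2 * \sum_x b2 x ^+ 2 <= \sum_x q x * b2 x ^+ 2 by lra.
  rewrite mulr_sumr; apply: ler_sum => x _; rewrite /b2.
  have [_|/q_out] := boolP (x \in C) => /=.
    by rewrite subrr mul0r expr0n !mulr0.
  by rewrite subr0 mul1r; apply: ler_wpM2r; rewrite sqr_ge0.
have inner : - (2^-1 * coupling J b1 b1 + coupling J b1 b2) <=
    \sum_x q x * b1 x ^+ 2.
  rewrite mulr_sumr -big_split -sumrN; apply: ler_sum => x _ /=.
  have [xC|xC] := boolP (x \in C); last first.
    rewrite /b1 (negPf xC) mul0r expr0n mulr0.
    rewrite !big1 ?mulr0 ?addr0 ?oppr0// => y _; ring.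
  have := ler_wpM2r (sqr_ge0 (b1 x)) (q_in xC); apply: le_trans.
  rewrite row_sum_inE mulr_suml mulr_sumr -big_split -sumrN.
  apply: ler_sum => y _ /=.
  (* For [y] in [C] only [b1 y] survives and the factor is at most 1/2; otherwise only [b2 y]
     survives and it is at most 1. These are exactly the weights of the row sum. *)
  have -> : - (2^-1 * (J x y * b1 x * b1 y) + J x y * b1 x * b2 y) =
      - (J x y * (b1 x * (2^-1 * b1 y + b2 y))) by ring.
  apply: le_trans (ler_norm _) _; rewrite normrN normrM -[leRHS]mulrA.
  apply: ler_wpM2l => //; rewrite /b1 /b2 xC ler_norml.
  by have [] := b01 x; have [] := b01 y; case: (y \in C) => /= -> ->;
    apply/andP; split; lra.
suff -> : \sum_x q x * b x ^+ 2 =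
    \sum_x q x * b1 x ^+ 2 + \sum_x q x * b2 x ^+ 2 by lra.
rewrite -big_split; apply: eq_bigr => x _ /=; rewrite /b1 /b2.
by case: (x \in C) => /=; ring.
Qed.

(** Sites whose spins do not enter the pair energy, so that flipping them costs nothing. *)
Definition isolated (x : V) : Prop :=
  [/\ forall y, J x y = 0, h x = 0 & q x = 0].

(** When [lam <= 0] the form of [J] is positive semidefinite with zero diagonal. On the sum of one
    coordinate vector and [e] times another it equals [2 * e * J x y], for both signs of [e]. *)
Lemma eigenvalue_le0 : lam <= 0 -> forall x y, J x y = 0.
Proof.
move=> lam_le0 x y.
have [->|xy] := eqVneq x y; first exact: J_diag.
have form_ge0 e : 0 <= e * J x y.
  have := eigenvalue_coupling (shift (site R x) e (site R y)) J_sym lamP.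
  rewrite coupling_shift// !coupling_site2// !J_diag.
  have : lam * \sum_z shift (site R x) e (site R y) z ^+ 2 <= 0.
    by rewrite mulr_le0_ge0// sumr_ge0// => z _; rewrite sqr_ge0.
  rewrite (J_sym y x); lra.
by have := form_ge0 1; have := form_ge0 (-1); lra.
Qed.

Definition mean_spin (s t : config V) (x : V) : R :=
  2^-1 * (spin R (s x) + spin R (t x)).

Definition half_diff (s t : config V) (x : V) : R :=
  2^-1 * (spin R (s x) - spin R (t x)).

Lemma half_diff_neq0 (s t : config V) x : (half_diff s t x != 0) = (s x != t x).
Proof.
by rewrite /half_diff /spin; case: (s x); case: (t x) => //=; apply/eqP; lra.
Qed.

Lemma mean_spin_eq0 (s t : config V) x : s x != t x -> mean_spin s t x = 0.
Proof. by rewrite /mean_spin /spin; case: (s x); case: (t x) => //= _; lra. Qed.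

Lemma mean_spin_sign s t : sign_or_zero (mean_spin s t).
Proof.
move=> x; rewrite /mean_spin /spin; case: (s x); case: (t x) => /=;
  by [constructor 1; lra|constructor 2; lra|constructor 3; lra].
Qed.

Lemma half_diff_sign s t : sign_or_zero (half_diff s t).
Proof.
move=> x; rewrite /half_diff /spin; case: (s x); case: (t x) => /=;
  by [constructor 1; lra|constructor 2; lra|constructor 3; lra].
Qed.

(** With [s = a + b] and [t = a - b] the cross terms cancel by symmetry of [J], and at each site the
    product of the spins is [1 - 2 * b x ^+ 2], which produces the constant. *)
Lemma sca_hamiltonianE s t : sca_hamiltonian J h q s t =
  relaxed_energy J h (mean_spin s t) + pinned_form (half_diff s t)
  - 2^-1 * \sum_x q x.
Proof.
have sE : (fun x => spin R (s x)) =1 shift (mean_spin s t) 1 (half_diff s t).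
  by move=> x; rewrite /shift /mean_spin /half_diff; field.
have tE : (fun x => spin R (t x)) =1 shift (mean_spin s t) (-1) (half_diff s t).
  by move=> x; rewrite /shift /mean_spin /half_diff; field.
rewrite /sca_hamiltonian.
rewrite -/(coupling J (fun x => spin R (s x)) (fun x => spin R (t x))).
rewrite (eq_coupling _ sE tE) coupling_shiftl// couplingC// coupling_shiftl//.
rewrite [coupling J (half_diff s t) (shift _ _ _)]couplingC// coupling_shiftl//.
rewrite [coupling J (half_diff s t) (mean_spin s t)]couplingC//.
rewrite /relaxed_energy /pinned_form.
have -> : \sum_x h x * mean_spin s t x =
    2^-1 * \sum_x h x * (spin R (s x) + spin R (t x)).
  by rewrite mulr_sumr; apply: eq_bigr => x _; rewrite /mean_spin; ring.
have -> : \sum_x q x * spin R (s x) * spin R (t x) =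
    \sum_x q x - 2 * \sum_x q x * half_diff s t x ^+ 2.
  rewrite mulr_sumr -sumrB; apply: eq_bigr => x _; rewrite /half_diff /spin.
  by case: (s x); case: (t x) => /=; field.
by field.
Qed.

Variable m : R.
Hypothesis m_min : forall s, m <= hamiltonian J h s.

Lemma sca_hamiltonian_ge s t :
  m - 2^-1 * \sum_x q x <= sca_hamiltonian J h q s t.
Proof.
rewrite sca_hamiltonianE lerD2r -[m]addr0 lerD ?pinned_form_ge0//.
  by apply: relaxed_energy_ge m_min _ => //; exact: mean_spin_sign.
exact: half_diff_sign.
Qed.

(** Equality makes both parts of the decomposition minimal. The mean [a] vanishes where [s] and [t]
    differ, so couplings among those sites vanish and only the terms [q y * b y ^+ 2] of the form
    remain; this gives [q x = 0], then the row of [J], then [h x]. *)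
Lemma sca_hamiltonian_min_isolated (s t : config V) x :
  sca_hamiltonian J h q s t = m - 2^-1 * \sum_x q x -> s x != t x ->
  isolated x.
Proof.
set a := mean_spin s t; set b := half_diff s t.
have a01 : sign_or_zero a := mean_spin_sign s t.
rewrite sca_hamiltonianE -/a -/b => /addIr st_min st_x.
have a_ge : m <= relaxed_energy J h a by exact: relaxed_energy_ge m_min _.
have b_ge : 0 <= pinned_form b by apply: pinned_form_ge0; exact: half_diff_sign.
have a_min : relaxed_energy J h a = m by lra.
have b_min : pinned_form b = 0 by lra.
have a_x0 : a x = 0 by exact: mean_spin_eq0.
have b0_or_a0 y : b y = 0 \/ a y = 0.
  have [sty|sty] := boolP (s y == t y); last by right; exact: mean_spin_eq0.
  by left; apply/eqP; rewrite -[_ == _]negbK half_diff_neq0 sty.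
have b_coupling : coupling J b b = 0.
  rewrite /coupling big1// => y _; rewrite big1// => z _.
  have [->|ay] := b0_or_a0 y; first by ring.
  have [->|az] := b0_or_a0 z; first by ring.
  by rewrite (minimal_coupling_eq0 J_sym J_diag m_min a01 a_min ay az) !mul0r.
have q_x : q x = 0.
  move: b_min; rewrite /pinned_form b_coupling mulr0 add0r => /eqP.
  rewrite psumr_eq0 => [|y _]; last by rewrite mulr_ge0 ?pinning_ge0 ?sqr_ge0.
  move=> /allP/(_ x (mem_index_enum x)) /=.
  by rewrite mulf_eq0 sqrf_eq0 (negPf _ : (b x == 0) = false) ?orbF
    ?half_diff_neq0// => /eqP.
(* With [q x = 0] the condition is tight: outside [C] it gives [lam <= 0], inside [C] a positively
   weighted row sum that is at most zero. *)
have J_x y : J x y = 0.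
  have [xC|xC] := boolP (x \in C); last first.
    by apply: eigenvalue_le0; have := q_out xC; rewrite q_x; lra.
  have := q_in xC; rewrite q_x row_sum_inE => row_le0.
  have term_ge0 z : 0 <= `|J x z| * (1 - 2^-1 * in_C z).
    by rewrite mulr_ge0// ltW// in_C_weight_gt0.
  have : \sum_z `|J x z| * (1 - 2^-1 * in_C z) == 0.
    by rewrite eq_le row_le0 sumr_ge0.
  rewrite psumr_eq0// => /allP/(_ y (mem_index_enum y)) /=.
  by rewrite mulf_eq0 (gt_eqF (in_C_weight_gt0 y)) orbF normr_eq0 => /eqP.
split=> //; have := local_field_eq0 J_sym J_diag m_min a01 a_min a_x0.
by rewrite /local_field big1 ?add0r// => y _; rewrite J_x mul0r.
Qed.

Lemma sca_hamiltonian_diag s :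
  sca_hamiltonian J h q s s = hamiltonian J h s - 2^-1 * \sum_x q x.
Proof.
rewrite /sca_hamiltonian /hamiltonian; congr (_ - _ - _).
  by rewrite mulr_sumr; apply: eq_bigr => x _; field.
by congr (_ * _); apply: eq_bigr => x _; rewrite /spin; case: (s x); ring.
Qed.

Lemma sca_hamiltonian_isolated (s t : config V) :
  (forall x, s x != t x -> isolated x) ->
  sca_hamiltonian J h q s t = sca_hamiltonian J h q s s.
Proof.
move=> st; rewrite /sca_hamiltonian; congr (- (_ * _) - (_ * _) - (_ * _)).
- apply: eq_bigr => x _; apply: eq_bigr => y _.
  have [->//|/st[Jy _ _]] := eqVneq (s y) (t y).
  by rewrite J_sym Jy !mul0r.
- apply: eq_bigr => x _; have [->//|/st[_ -> _]] := eqVneq (s x) (t x).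
  by rewrite !mul0r.
- apply: eq_bigr => x _; have [->//|/st[_ _ ->]] := eqVneq (s x) (t x).
  by rewrite !mul0r.
Qed.

End Pinning.

(** * Low-temperature limit of Gibbs weights *)

Section GibbsLimit.
Variables (R : realType) (T : finType) (g : T -> T -> R).
Hypothesis g_ge0 : forall s t, 0 <= g s t.
Hypothesis g_zero : exists s t, g s t = 0.

(** [g] stands for the pair energy measured from its minimum. *)
Definition gap_weight (beta : R) (s : T) : R :=
  \sum_t expR (- (beta * g s t)).

Definition gap_partition (beta : R) : R := \sum_s gap_weight beta s.

(** The number of minimizing partners of [s], which is the limit of [gap_weight] as [beta] tends to
    infinity. *)
Definition zero_gaps (s : T) : R := \sum_t (g s t == 0)%:R.

Lemma gap_weight_ge0 beta s : 0 <= gap_weight beta s.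
Proof. by apply: sumr_ge0 => t _; exact: expR_ge0. Qed.

Lemma gap_weight_anti beta beta' s :
  beta <= beta' -> gap_weight beta' s <= gap_weight beta s.
Proof.
by move=> bb'; apply: ler_sum => t _; rewrite ler_expR lerN2 ler_wpM2r.
Qed.

(** A pair with zero gap contributes [expR 0 = 1] at every temperature. *)
Lemma gap_partition_ge1 beta : 1 <= gap_partition beta.
Proof.
have [s [t st0]] := g_zero.
rewrite /gap_partition (bigD1 s)//= {1}/gap_weight (bigD1 t)//= st0.
rewrite mulr0 oppr0 expR0 -addrA lerDl addr_ge0//.
  by apply: sumr_ge0 => i _; exact: expR_ge0.
by apply: sumr_ge0 => i _; exact: gap_weight_ge0.
Qed.

(* Numerator and denominator are both nonincreasing in [beta] and the
   denominator stays above 1, so that no derivative in [beta] is needed. *)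
Lemma gibbs_variation beta beta' s : beta <= beta' ->
  `|gap_weight beta' s / gap_partition beta' -
    gap_weight beta s / gap_partition beta| <=
  (gap_weight beta s - gap_weight beta' s) +
  (gap_partition beta - gap_partition beta').
Proof.
move=> bb'.
have Z1 := gap_partition_ge1 beta; have Z'1 := gap_partition_ge1 beta'.
have A'A := gap_weight_anti s bb'.
have Z'Z : gap_partition beta' <= gap_partition beta.
  by apply: ler_sum => t _; exact: gap_weight_anti.
have A_ge0 := gap_weight_ge0 beta s.
have AZ : gap_weight beta s <= gap_partition beta.
  rewrite /gap_partition (bigD1 s)//= lerDl; apply: sumr_ge0 => t _.
  exact: gap_weight_ge0.
move: (gap_weight beta s) (gap_weight beta' s) (gap_partition beta)
  (gap_partition beta') => A A' Z Z' in Z1 Z'1 A'A Z'Z A_ge0 AZ *.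
have Z_gt0 : 0 < Z by apply: lt_le_trans Z1.
have Z'_gt0 : 0 < Z' by apply: lt_le_trans Z'1.
(* Both terms of the numerator are nonnegative; [A / Z <= 1], and division by [Z' >= 1] does not
   increase the absolute value. *)
have -> : A' / Z' - A / Z = (A / Z * (Z - Z') - (A - A')) / Z'.
  by field; rewrite !gt_eqF.
rewrite normrM [`|Z'^-1|]gtr0_norm ?invr_gt0// ler_pdivrMr//.
have AZ_ge0 : 0 <= A / Z by rewrite divr_ge0// ltW.
have AZ_le1 : A / Z <= 1 by rewrite ler_pdivrMr// mul1r.
apply: le_trans (ler_peMr _ Z'1); last by rewrite addr_ge0 ?subr_ge0.
apply: le_trans (ler_normB _ _) _; rewrite addrC lerD//.
  by rewrite ger0_norm ?subr_ge0.
have ZZ'_ge0 : 0 <= Z - Z' by rewrite subr_ge0.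
by rewrite ger0_norm ?(mulr_ge0 AZ_ge0)// ler_piMl.
Qed.

(** Summed over [s], the weight drops give one partition drop and the constant terms give [#|T|]
    more. *)
Lemma tv_gibbs_variation beta beta' : beta <= beta' ->
  tv_dist (fun s => gap_weight beta' s / gap_partition beta')
          (fun s => gap_weight beta s / gap_partition beta) <=
  (1 + #|T|%:R) / 2 * (gap_partition beta - gap_partition beta').
Proof.
move=> bb'; rewrite /tv_dist mulrAC mulrC ler_pM2r ?invr_gt0//.
apply: le_trans (ler_sum _ (fun s _ => gibbs_variation s bb')) _.
rewrite big_split sumrB /= -/(gap_partition beta) -/(gap_partition beta').
by rewrite sumr_const -[_ *+ #|_|]mulr_natl mulrDl mul1r.
Qed.

Lemma gap_weight_cvg (beta : nat -> R) s : beta t @[t --> \oo] --> +oo ->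
  gap_weight (beta t) s @[t --> \oo] --> zero_gaps s.
Proof.
move=> betaoo; apply: cvg_sumr => t.
have [->|st_neq0] := eqVneq (g s t) 0.
  by under eq_cvg do rewrite mulr0 oppr0 expR0; exact: cvg_cst.
apply: (@cvg_comp _ _ _ beta (fun x => expR (- (x * g s t))) _ _ _ betaoo).
apply: (@cvg_comp _ _ _ (fun x => x * g s t) (fun x => expR (- x)) _ +oo);
  last exact: cvgr_expR.
apply: (@gt0_cvgMly _ _ _ (g s t) id); last exact: cvg_id.
by rewrite lt_neqAle eq_sym st_neq0 g_ge0.
Qed.

Lemma gap_partition_cvg (beta : nat -> R) : beta t @[t --> \oo] --> +oo ->
  gap_partition (beta t) @[t --> \oo] --> \sum_s zero_gaps s.
Proof. by move=> betaoo; apply: cvg_sumr => s; exact: gap_weight_cvg. Qed.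

Lemma sum_zero_gaps_gt0 : 0 < \sum_s zero_gaps s.
Proof.
have [s [t st0]] := g_zero.
rewrite (bigD1 s)//= {1}/zero_gaps (bigD1 t)//= st0 eqxx -addrA.
rewrite ltr_pwDl//; rewrite addr_ge0// sumr_ge0// => i _.
by apply: sumr_ge0.
Qed.

Lemma tv_gibbs_cvg (beta : nat -> R) : beta t @[t --> \oo] --> +oo ->
  tv_dist (fun s => gap_weight (beta t) s / gap_partition (beta t))
          (fun s => zero_gaps s / \sum_r zero_gaps r)
    @[t --> \oo] --> (0 : R).
Proof.
move=> betaoo; set p := fun s => _ / \sum_r _.
have term_cvg s : `|gap_weight (beta t) s / gap_partition (beta t) - p s|
    @[t --> \oo] --> (0 : R).
  rewrite -[X in _ --> X](@normr0 R R) -(subrr (p s)).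
  apply: cvg_norm; apply: cvgB; last exact: cvg_cst.
  apply: cvgM; first exact: gap_weight_cvg.
  by apply: cvgV; [rewrite gt_eqF// sum_zero_gaps_gt0|exact: gap_partition_cvg].
rewrite /tv_dist -[X in _ --> X](mulr0 2^-1).
apply: cvgM; first exact: cvg_cst.
rewrite -[X in _ --> X](@big1 R 0 +%R T (index_enum T) predT (fun=> 0))//.
exact: cvg_sumr.
Qed.

End GibbsLimit.

(** Partial sums are at most [K * (z 1 - z n)], hence at most [K * z 1]. *)
Lemma nneseries_telescope_lty (R : realType) (u z : nat -> R) (K : R) :
  0 <= K -> (forall t, 0 <= u t) -> (forall t, 0 <= z t) ->
  (forall t, (1 <= t)%N -> u t <= K * (z t - z t.+1)) ->
  (\sum_(1 <= t <oo) (u t)%:E < +oo)%E.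
Proof.
move=> K_ge0 u_ge0 z_ge0 u_le.
apply: (@le_lt_trans _ _ (K * z 1%N)%:E); last exact: ltry.
apply: lime_le.
  by apply: is_cvg_nneseries => n _ _; rewrite lee_fin.
near=> n; rewrite sumEFin lee_fin.
have n1 : (1 <= n)%N by near: n; exact: nbhs_infty_ge.
apply: (@le_trans _ _ (K * (z 1%N - z n))).
  rewrite -[z 1%N - z n]opprB -telescope_sumr// -sumrN mulr_sumr.
  by rewrite ler_sum_nat// => i /andP[i1 _]; rewrite opprB u_le.
by rewrite ler_wpM2l// gerBl.
Unshelve. all: by end_near.
Qed.

(** * Contraction under a Doeblin condition *)

Section Doeblin.
Variables (R : realType) (T : finType).
Implicit Types (mu nu : T -> R) (P : T -> T -> R).

Lemma tv_dist_ge0 mu nu : 0 <= tv_dist mu nu.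
Proof. by rewrite mulr_ge0 ?invr_ge0// sumr_ge0. Qed.

Lemma tv_dist_triangle mu nu rho :
  tv_dist mu rho <= tv_dist mu nu + tv_dist nu rho.
Proof.
rewrite /tv_dist -mulrDr ler_pM2l ?invr_gt0// -big_split ler_sum// => s _.
exact: ler_distD.
Qed.

Lemma tv_dist_le1 mu nu :
  is_distribution mu -> is_distribution nu -> tv_dist mu nu <= 1.
Proof.
move=> [mu_ge0 mu1] [nu_ge0 nu1]; rewrite /tv_dist ler_pdivrMl// mulr1.
have -> : 2 = \sum_s (mu s + nu s) by rewrite big_split /= mu1 nu1.
apply: ler_sum => s _; apply: le_trans (ler_normB _ _) _.
by rewrite !ger0_norm.
Qed.

Lemma dist_step_distribution mu P :
  (forall s, is_distribution (P s)) -> is_distribution mu ->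
  is_distribution (dist_step mu P).
Proof.
move=> Pdist [mu_ge0 mu1]; split.
  by move=> t; apply: sumr_ge0 => s _; rewrite mulr_ge0//; case: (Pdist s).
rewrite /dist_step exchange_big -[RHS]mu1; apply: eq_bigr => s _ /=.
by rewrite -mulr_sumr; case: (Pdist s) => _ ->; rewrite mulr1.
Qed.

(* Since [mu] and [nu] have the same mass, [c] may be subtracted from every
   entry of [P] without changing [mu P - nu P]. *)
Lemma tv_dist_step mu nu P (c : R) :
  (forall s, is_distribution (P s)) -> (forall s t, c <= P s t) ->
  is_distribution mu -> is_distribution nu ->
  tv_dist (dist_step mu P) (dist_step nu P) <=
  (1 - #|T|%:R * c) * tv_dist mu nu.
Proof.
move=> Pdist c_le [_ mu1] [_ nu1].
rewrite /tv_dist mulrCA ler_pM2l ?invr_gt0// mulr_sumr.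
have step_le t : `|dist_step mu P t - dist_step nu P t| <=
    \sum_s (P s t - c) * `|mu s - nu s|.
  have -> : dist_step mu P t - dist_step nu P t =
      \sum_s (P s t - c) * (mu s - nu s).
    have -> : \sum_s (P s t - c) * (mu s - nu s) =
        \sum_s (mu s * P s t - nu s * P s t) - \sum_s (c * mu s - c * nu s).
      by rewrite -sumrB; apply: eq_bigr => s _; ring.
    by rewrite !sumrB -!mulr_sumr mu1 nu1 subrr subr0.
  apply: le_trans (ler_norm_sum _ _ _) _; apply: ler_sum => s _.
  by rewrite normrM ger0_norm// subr_ge0.
apply: le_trans (ler_sum _ (fun t _ => step_le t)) _.
rewrite exchange_big; apply: ler_sum => s _ /=.
rewrite -mulr_suml sumrB sumr_const -[c *+ _]mulr_natl.
by case: (Pdist s) => _ ->.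
Qed.

(** Two numbers [a, b >= c] satisfy [|a - b| <= a + b - 2 * c]; summing over a row gives
    [2 - 2 * #|T| * c]. The bound on [#|T| * c] takes care of the default value 0 of the maxima. *)
Lemma dobrushin_le P (c : R) :
  (forall s, is_distribution (P s)) -> (forall s t, c <= P s t) ->
  #|T|%:R * c <= 1 -> dobrushin P <= 1 - #|T|%:R * c.
Proof.
move=> Pdist c_le c1.
apply: bigmax_le => [|s _]; first by rewrite subr_ge0.
apply: bigmax_le => [|t _]; first by rewrite subr_ge0.
rewrite /tv_dist ler_pdivrMl//.
apply: (@le_trans _ _ (\sum_r (P s r + P t r - 2 * c))).
  apply: ler_sum => r _; rewrite ler_norml.
  by have := c_le s r; have := c_le t r => ? ?; apply/andP; split; lra.
rewrite sumrB big_split /=; case: (Pdist s) (Pdist t) => _ -> [_ ->].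
by rewrite sumr_const -[_ *+ #|_|]mulr_natl; lra.
Qed.

(** This includes [j = t.+1], where the shorter evolution is still [mu]. *)
Lemma dist_evolve_recr (P : nat -> T -> T -> R) mu j t : (j <= t.+1)%N ->
  dist_evolve P mu j t.+1 = dist_step (dist_evolve P mu j t) (P t.+1).
Proof.
move=> jt; rewrite /dist_evolve /index_iota subSn// -addn1 iotaD foldl_cat /=.
by rewrite subnKC.
Qed.

Lemma dist_evolve_distribution (P : nat -> T -> T -> R) mu j t :
  (forall k s, is_distribution (P k s)) -> is_distribution mu ->
  is_distribution (dist_evolve P mu j t).
Proof.
rewrite /dist_evolve => Pdist; elim: (index_iota j t.+1) mu => //= k r IHr mu mud.
by apply: IHr; exact: dist_step_distribution.
Qed.

(* With contraction factors [1 - 1/t] the products telescope: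
   [(1 - 1/(N+1)) ... (1 - 1/t) = N/t]. *)
Lemma tv_dist_evolve (P : nat -> T -> T -> R) (pi : nat -> T -> R) mu
    (j N t : nat) :
  (forall k s, is_distribution (P k s)) ->
  (forall k s r, (1 <= k)%N -> (#|T|%:R * k%:R)^-1 <= P k s r) ->
  (forall k, is_distribution (pi k)) ->
  (forall k, dist_step (pi k) (P k) = pi k) ->
  is_distribution mu -> (1 <= N)%N -> (j <= N)%N -> (N <= t)%N ->
  tv_dist (dist_evolve P mu j t) (pi t) <=
  N%:R / t%:R + \sum_(N <= k < t) tv_dist (pi k.+1) (pi k).
Proof.
move=> Pdist P_ge pidist pistep mud N1 jN.
have N0 : (N%:R : R) != 0 by rewrite pnatr_eq0 -lt0n.
elim: t => [|t IHt]; first by rewrite leqn0 => /eqP N0'; rewrite N0' in N1.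
rewrite leq_eqVlt => /predU1P[<-|Nt].
  rewrite big_geq// addr0 divff//.
  by apply: tv_dist_le1 => //; exact: dist_evolve_distribution.
rewrite big_nat_recr//=; rewrite ltnS in Nt.
rewrite dist_evolve_recr; last by rewrite (leq_trans jN)// ltnW.
rewrite -{1}(pistep t.+1).
have evd := dist_evolve_distribution j t Pdist mud.
(* The state space is nonempty because [mu] has mass 1. *)
have T_gt0 : (0 : R) < #|T|%:R.
  rewrite ltr0n lt0n; apply/negP => /eqP/card0_eq T0.
  have [_] := mud; rewrite big_pred0 => [/eqP|s]; last by rewrite -[RHS](T0 s).
  by rewrite eq_sym oner_eq0.
have t_gt0 : (0 : R) < t%:R by rewrite ltr0n (leq_trans N1).
have := tv_dist_step (Pdist t.+1) (fun s r => P_ge t.+1 s r isT) evd (pidist t.+1).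
move=> /le_trans; apply.
(* This factor turns [N / t] into [N / t.+1]. *)
have -> : 1 - #|T|%:R * (#|T|%:R * t.+1%:R)^-1 = t%:R / t.+1%:R :> R.
  rewrite invfM mulrA divff ?gt_eqF// mul1r -natr1; field.
  by rewrite gt_eqF// ltr_wpDr.
have t_le : t%:R / t.+1%:R <= 1 :> R by rewrite ler_pdivrMr// mul1r ler_nat.
apply: le_trans (ler_wpM2l _ (tv_dist_triangle _ (pi t) _)) _.
  by rewrite divr_ge0.
rewrite mulrDr addrA lerD//; last first.
  rewrite (_ : tv_dist (pi t) _ = tv_dist (pi t.+1) (pi t)).
    by rewrite ler_piMl// tv_dist_ge0.
  by rewrite /tv_dist; under eq_bigr do rewrite distrC.
apply: le_trans (ler_wpM2l _ (IHt Nt)) _; first by rewrite divr_ge0.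
rewrite mulrDr lerD//.
  by rewrite mulrC mulrA divfK// gt_eqF.
by rewrite ler_piMl// sumr_ge0// => k _; exact: tv_dist_ge0.
Qed.

End Doeblin.

(** * The automaton *)

Section AutomatonKernel.
Variables (R : realType) (V : finType) (J : V -> V -> R) (h q : V -> R).
Implicit Types (beta : R) (s t : config V).

Lemma sca_weight_gt0 beta s : 0 < sca_weight J h q beta s.
Proof.
by rewrite /sca_weight (bigD1 s)//= ltr_pwDl ?expR_gt0// sumr_ge0.
Qed.

Lemma sca_partition_gt0 beta : 0 < \sum_s sca_weight J h q beta s.
Proof.
rewrite (bigD1 [ffun=> true])//= ltr_pwDl ?sca_weight_gt0// sumr_ge0// => t _.
exact/ltW/sca_weight_gt0.
Qed.

Lemma sca_trans_distribution beta s :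
  is_distribution (sca_trans J h q beta s).
Proof.
split=> [t|]; first by rewrite divr_ge0 ?expR_ge0// ltW// sca_weight_gt0.
by rewrite -mulr_suml mulfV// gt_eqF// sca_weight_gt0.
Qed.

Lemma sca_equilibrium_distribution beta :
  is_distribution (sca_equilibrium J h q beta).
Proof.
split=> [s|]; last by rewrite -mulr_suml mulfV// gt_eqF// sca_partition_gt0.
by rewrite divr_ge0// ltW// ?sca_weight_gt0 ?sca_partition_gt0.
Qed.

(** Shifting the energy by [e0] multiplies every weight by the same factor, which cancels on
    normalization. *)
Lemma sca_equilibrium_gap e0 beta s :
  let g s t := sca_hamiltonian J h q s t - e0 in
  sca_equilibrium J h q beta s = gap_weight g beta s / gap_partition g beta.
Proof.
move=> g; have weightE r :
    sca_weight J h q beta r = expR (- (beta * e0)) * gap_weight g beta r.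
  rewrite mulr_sumr; apply: eq_bigr => t _; rewrite -expRD /g; congr expR; ring.
rewrite /sca_equilibrium weightE; under eq_bigr do rewrite weightE.
by rewrite -mulr_sumr -mulf_div divff ?mul1r// gt_eqF// expR_gt0.
Qed.

Hypothesis J_sym : forall x y, J x y = J y x.

Lemma sca_hamiltonianC s t :
  sca_hamiltonian J h q s t = sca_hamiltonian J h q t s.
Proof.
rewrite /sca_hamiltonian; congr (- (_ * _) - (_ * _) - (_ * _)).
- exact: (couplingC J_sym (fun x => spin R (s x)) (fun x => spin R (t x))).
- by apply: eq_bigr => x _; rewrite [spin R (s x) + _]addrC.
- by apply: eq_bigr => x _; rewrite mulrAC.
Qed.

(** Detailed balance: the weight of [s] times its transition probability to [t] is the Boltzmann
    factor of the pair, symmetric in [s] and [t]. *)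
Lemma sca_stationary beta :
  dist_step (sca_equilibrium J h q beta) (sca_trans J h q beta) =
  sca_equilibrium J h q beta.
Proof.
apply/funext => t.
rewrite /dist_step /sca_equilibrium [in RHS]/sca_weight mulr_suml.
apply: eq_bigr => s _; rewrite /sca_trans sca_hamiltonianC.
by field; rewrite !gt_eqF ?sca_partition_gt0 ?sca_weight_gt0.
Qed.

Hypothesis q_ge0 : forall x, 0 <= q x.

(** Changing the second argument changes each spin by at most 2, which cancels the prefactor 1/2.
    Nonnegativity of [q] lets [q x] stand in [Gamma] without absolute value. *)
Lemma sca_hamiltonian_osc s t t' :
  sca_hamiltonian J h q s t - sca_hamiltonian J h q s t' <= Gamma J h q.
Proof.
have -> : Gamma J h q =
    2^-1 * \sum_x \sum_y `|J x y| * 2 + 2^-1 * \sum_x `|h x| * 2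
    + 2^-1 * \sum_x q x * 2.
  under eq_bigr => x _ do rewrite -mulr_suml.
  by rewrite -!mulr_suml /Gamma /Gamma_site !big_split /=; field.
have -> : sca_hamiltonian J h q s t - sca_hamiltonian J h q s t' =
    2^-1 * \sum_x \sum_y J x y * (spin R (s x) * (spin R (t' y) - spin R (t y)))
    + 2^-1 * \sum_x h x * (spin R (t' x) - spin R (t x))
    + 2^-1 * \sum_x q x * (spin R (s x) * (spin R (t' x) - spin R (t x))).
  have -> : \sum_x \sum_y J x y * (spin R (s x) * (spin R (t' y) - spin R (t y))) =
      \sum_x \sum_y J x y * spin R (s x) * spin R (t' y) -
      \sum_x \sum_y J x y * spin R (s x) * spin R (t y).
    rewrite -sumrB; apply: eq_bigr => x _; rewrite -sumrB.
    by apply: eq_bigr => y _; ring.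
  have -> : \sum_x h x * (spin R (t' x) - spin R (t x)) =
      \sum_x h x * (spin R (s x) + spin R (t' x)) -
      \sum_x h x * (spin R (s x) + spin R (t x)).
    by rewrite -sumrB; apply: eq_bigr => x _; ring.
  have -> : \sum_x q x * (spin R (s x) * (spin R (t' x) - spin R (t x))) =
      \sum_x q x * spin R (s x) * spin R (t' x) -
      \sum_x q x * spin R (s x) * spin R (t x).
    by rewrite -sumrB; apply: eq_bigr => x _; ring.
  rewrite /sca_hamiltonian; ring.
have diff_le x : `|spin R (t' x) - spin R (t x)| <= 2.
  by rewrite /spin; case: (t' x); case: (t x); rewrite ler_norml;
    apply/andP; split; lra.
have sdiff_le x y : `|spin R (s x) * (spin R (t' y) - spin R (t y))| <= 2.
  by rewrite normrM; have -> : `|spin R (s x)| = 1;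
    rewrite ?mul1r// /spin; case: (s x); rewrite ?normrN normr1.
rewrite !lerD// ler_pM2l ?invr_gt0// ler_sum// => x _.
- apply: ler_sum => y _; apply: le_trans (ler_norm _) _.
  by rewrite normrM ler_wpM2l.
- by apply: le_trans (ler_norm _) _; rewrite normrM ler_wpM2l.
- apply: ler_wpM2l => //; exact: le_trans (ler_norm _) _.
Qed.

(** The inverse probability is a sum over [t'] of exponentials of [beta] times an energy difference,
    each at most [expR (beta * Gamma)]. *)
Lemma sca_trans_ge beta s t : 0 <= beta ->
  (#|{: config V}|%:R * expR (beta * Gamma J h q))^-1 <= sca_trans J h q beta s t.
Proof.
move=> beta_ge0; rewrite /sca_trans ler_pdivlMr ?sca_weight_gt0//.
have config_gt0 : (0 : R) < #|{: config V}|%:R.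
  by rewrite ltr0n; apply/card_gt0P; exists s.
rewrite mulrC ler_pdivrMr ?mulr_gt0 ?expR_gt0//.
rewrite mulrCA -expRD mulr_natl -sumr_const /sca_weight; apply: ler_sum => t' _.
rewrite ler_expR.
have := ler_wpM2l beta_ge0 (sca_hamiltonian_osc s t t').
by rewrite mulrBr; lra.
Qed.

End AutomatonKernel.

(** * Uniform limit on the ground states *)

Section GroundStates.
Variables (R : realType) (V : finType) (J : V -> V -> R) (h q : V -> R).
Variables (lam : R) (C : {set V}).
Hypothesis J_sym : forall x y, J x y = J y x.
Hypothesis J_diag : forall x, J x x = 0.
Hypothesis lamP : largest_eigenvalue (neg_coupling_mx J) lam.
Hypothesis q_in : forall x, x \in C ->
  \sum_y `|J x y| - 2^-1 * \sum_(y in C) `|J x y| <= q x.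
Hypothesis q_out : forall x, x \notin C -> lam / 2 <= q x.

(** The constant configuration only seeds the minimization. *)
Definition ground_energy : R :=
  hamiltonian J h [arg min_(s < [ffun=> true] : config V) hamiltonian J h s]%O.

Lemma ground_energy_le s : ground_energy <= hamiltonian J h s.
Proof. by rewrite /ground_energy; case: arg_minP => // r _; exact. Qed.

Lemma ground_statesE s :
  (s \in ground_states J h) = (hamiltonian J h s == ground_energy).
Proof.
rewrite finset.in_set eq_le ground_energy_le andbT.
apply/forallP/idP => [|s_le t]; first exact.
exact: le_trans s_le (ground_energy_le t).
Qed.

Definition gap (s t : config V) : R :=
  sca_hamiltonian J h q s t - (ground_energy - 2^-1 * \sum_x q x).

Lemma gap_ge0 s t : 0 <= gap s t.
Proof.
rewrite subr_ge0.
exact: sca_hamiltonian_ge lamP q_in q_out _ ground_energy_le _ _.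
Qed.

Lemma gap_diag_eq0 s : (gap s s == 0) = (s \in ground_states J h).
Proof.
by rewrite ground_statesE /gap sca_hamiltonian_diag subr_eq0 (inj_eq (addIr _)).
Qed.

(** A zero gap makes every site of disagreement isolated, so [t] may be replaced by [s]; on the
    diagonal the gap is the energy of [s] above the minimum. *)
Lemma gap_eq0P (s t : config V) : reflect
  (s \in ground_states J h /\ forall x, s x != t x -> isolated J h q x)
  (gap s t == 0).
Proof.
apply: (iffP idP) => [st0|[s_gs st]]; last first.
  by rewrite /gap (sca_hamiltonian_isolated J_sym st) -/(gap s s) gap_diag_eq0.
have st x : s x != t x -> isolated J h q x.
  apply: sca_hamiltonian_min_isolated lamP q_in q_out _ ground_energy_le
    _ _ _ _ => //.
  by apply/eqP; rewrite -subr_eq0.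
by split=> //; rewrite -gap_diag_eq0 /gap -(sca_hamiltonian_isolated J_sym st).
Qed.

Lemma gap_has_zero : exists s t, gap s t = 0.
Proof.
pose s := [arg min_(s < [ffun=> true] : config V) hamiltonian J h s]%O.
by exists s, s; apply/eqP; rewrite gap_diag_eq0 ground_statesE.
Qed.

(* All ground states have the same number of zero-gap partners: two such
   partners differ exactly on isolated sites, and this set of sites does not
   depend on the ground state. *)
Lemma zero_gaps_ground s s' :
  s \in ground_states J h -> s' \in ground_states J h ->
  zero_gaps gap s = zero_gaps gap s'.
Proof.
move=> s_gs s'_gs.
(* [phi] flips [t] where [s] and [s'] differ, so [phi t] disagrees with [s'] exactly where [t]
   disagrees with [s]. *)
pose phi (t : config V) : config V := [ffun x => t x (+) (s x (+) s' x)].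
have phiK : involutive phi.
  by move=> t; apply/ffunP => x; rewrite !ffunE -addbA addbb addbF.
rewrite [RHS](reindex_inj (inv_inj phiK)); apply: eq_bigr => t _ /=.
congr (_%:R); congr nat_of_bool.
have phi_neq x : (s' x != phi t x) = (s x != t x).
  by rewrite ffunE; case: (s x) (s' x) (t x) => [] [] [].
by apply/gap_eq0P/gap_eq0P => -[_ st]; split=> // x;
  [rewrite phi_neq|rewrite -phi_neq]; exact: st.
Qed.

Lemma zero_gaps_excited s : s \notin ground_states J h -> zero_gaps gap s = 0.
Proof.
move=> s_ex; rewrite /zero_gaps big1// => t _.
by case: gap_eq0P => // -[s_gs]; rewrite s_gs in s_ex.
Qed.

(** The common number of partners cancels; it is nonzero because the total is positive. *)
Lemma pi_ground_zero_gaps s :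
  zero_gaps gap s / \sum_r zero_gaps gap r = pi_ground J h s.
Proof.
rewrite /pi_ground; case: ifPn => s_gs; last by rewrite zero_gaps_excited ?mul0r.
have sumE : \sum_r zero_gaps gap r = #|ground_states J h|%:R * zero_gaps gap s.
  rewrite (bigID (mem (ground_states J h)))/= [X in _ + X]big1 ?addr0; last first.
    by move=> r; exact: zero_gaps_excited.
  rewrite (eq_bigr (fun=> zero_gaps gap s)); last first.
    by move=> r r_gs; exact: zero_gaps_ground.
  by rewrite sumr_const mulr_natl.
have := sum_zero_gaps_gt0 gap_has_zero; rewrite sumE => sum_gt0.
have : zero_gaps gap s != 0.
  by apply: contraTneq sum_gt0 => ->; rewrite mulr0 ltxx.
by move=> ?; rewrite invfM mulrC -mulrA mulVf ?mulr1.
Qed.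

Lemma tv_sca_variation beta beta' : beta <= beta' ->
  tv_dist (sca_equilibrium J h q beta') (sca_equilibrium J h q beta) <=
  (1 + #|{: config V}|%:R) / 2 *
    (gap_partition gap beta - gap_partition gap beta').
Proof.
move=> bb'; rewrite [leLHS](_ : _ = tv_dist
  (fun s => gap_weight gap beta' s / gap_partition gap beta')
  (fun s => gap_weight gap beta s / gap_partition gap beta)).
  exact: (tv_gibbs_variation gap_ge0 gap_has_zero).
by congr tv_dist; apply/funext => s; exact: sca_equilibrium_gap.
Qed.

Lemma tv_sca_cvg (beta : nat -> R) : beta t @[t --> \oo] --> +oo ->
  tv_dist (sca_equilibrium J h q (beta t)) (pi_ground J h)
    @[t --> \oo] --> (0 : R).
Proof.
move=> betaoo.
have eqE t : sca_equilibrium J h q (beta t) =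
    fun s => gap_weight gap (beta t) s / gap_partition gap (beta t).
  by apply/funext => s; exact: sca_equilibrium_gap.
under eq_cvg do rewrite eqE.
rewrite -(funext pi_ground_zero_gaps).
exact: (tv_gibbs_cvg gap_ge0 gap_has_zero).
Qed.

End GroundStates.

(** * Limit criteria and the logarithmic schedule *)

Lemma ereal_cvg0 (R : realType) (D : nat -> \bar R) :
  (forall t, (0 <= D t)%E) ->
  (forall e : R, 0 < e -> \forall t \near \oo, (D t <= e%:E)%E) ->
  D t @[t --> \oo] --> 0%E.
Proof.
move=> D_ge0 D_le; apply/fine_cvgP; split.
  (* The bound at level 1 makes the values finite from some time on. *)
  near=> t; rewrite ge0_fin_numE//.
  by apply: (@le_lt_trans _ _ 1%:E); [near: t; exact: D_le|exact: ltry].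
apply/cvgrPdist_le => e e_gt0; near=> t.
have : (D t <= e%:E)%E by near: t; exact: D_le.
have := D_ge0 t; rewrite sub0r normrN /=.
by case: (D t) => [r| |]; rewrite ?lee_fin//= => r_ge0; rewrite ger0_norm.
Unshelve. all: by end_near.
Qed.

Lemma ln_div_cvgy (R : realType) (c : R) : 0 < c ->
  ln (t%:R : R) / c @[t --> \oo] --> +oo.
Proof.
move=> c_gt0; apply/cvgryPge => A; near=> t.
have t_ge : expR (A * c) <= t%:R by near: t; exact: nbhs_infty_ger.
rewrite ler_pdivlMr// -ler_expR lnK// posrE.
exact: lt_le_trans (expR_gt0 _) t_ge.
Unshelve. all: by end_near.
Qed.

Lemma nneseries_ge_harmonic (R : realType) (u : nat -> R) :
  (forall t, 0 <= u t) -> (forall t, (1 <= t)%N -> t%:R^-1 <= u t) ->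
  (\sum_(1 <= t <oo) (u t)%:E = +oo)%E.
Proof.
move=> u_ge0 u_ge; apply/eqyP => A _.
have /nondecreasing_dvgn_lt/(_ (@dvg_harmonic R)) :
    nondecreasing_seq (series (@harmonic R)).
  by apply: nondecreasing_series => n _ _; exact: harmonic_ge0.
move=> /cvgryPge/(_ A)[n _ /(_ n (leqnn n)) /= A_le].
apply: (@le_trans _ _ (\sum_(1 <= t < n.+1) (u t)%:E)%E); last first.
  by apply: nneseries_lim_ge => t _ _; rewrite lee_fin.
(* [harmonic] is indexed from 0 with first term 1, hence the shift of the sum. *)
rewrite sumEFin lee_fin (le_trans A_le)// big_add1 /series /=.
by apply: ler_sum_nat => t _; exact: u_ge.
Qed.

Theorem theorem3p2 (R : realType) (V : finType) (edge : rel V)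
  (J : V -> V -> R) (h q : V -> R) (lam : R) (C : {set V})
  (V_nonempty : (0 < #|V|)%N)
  (edge_sym : symmetric edge) (edge_irr : irreflexive edge)
  (J_sym : forall x y, J x y = J y x)
  (J_edge : forall x y, ~~ edge x y -> J x y = 0)
  (lamP : largest_eigenvalue (neg_coupling_mx J) lam)
  (q_in : forall x, x \in C ->
     \sum_y `|J x y| - 2^-1 * \sum_(y in C) `|J x y| <= q x)
  (q_out : forall x, x \notin C -> lam / 2 <= q x) :
  (forall beta : nat -> R,
     (forall t, (1 <= t)%N -> 0 <= beta t) ->
     (forall s t, (1 <= s)%N -> (s <= t)%N -> beta s <= beta t) ->
     beta t @[t --> \oo] --> +oo ->
     (\sum_(1 <= t <oo)
        (tv_dist (sca_equilibrium J h q (beta t.+1))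
                 (sca_equilibrium J h q (beta t)))%:E < +oo)%E
     /\ tv_dist (sca_equilibrium J h q (beta t)) (pi_ground J h)
          @[t --> \oo] --> (0 : R))
  /\
  (0 < Gamma J h q ->
   let P (t : nat) := sca_trans J h q (ln (t%:R : R) / Gamma J h q) in
   (\sum_(1 <= t <oo) (1 - dobrushin (P t))%:E = +oo)%E
   /\ forall j : nat, (1 <= j)%N ->
      ereal_sup [set (tv_dist (dist_evolve P mu j t) (pi_ground J h))%:E
                | mu in @is_distribution R (config V)]
        @[t --> \oo] --> 0%E).
Proof.
have J_diag x : J x x = 0 by apply: J_edge; rewrite edge_irr.
have variation := tv_sca_variation h J_sym J_diag lamP q_in q_out.
have equil_cvg := tv_sca_cvg h J_sym J_diag lamP q_in q_out.
set Z := gap_partition (gap J h q) in variation.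
have Z_ge0 beta : 0 <= Z beta.
  by rewrite (le_trans ler01)//; exact/gap_partition_ge1/gap_has_zero.
set K := _ / 2 in variation.
have K_ge0 : 0 <= K by rewrite divr_ge0// addr_ge0.
split=> [beta _ beta_nd beta_y|Gamma_gt0 P].
  split; last exact: equil_cvg.
  apply: (@nneseries_telescope_lty _ _ (fun t => Z (beta t)) K) => // [t|t t1].
    exact: tv_dist_ge0.
  exact/variation/beta_nd.
have q_ge0 := pinning_ge0 J_sym J_diag lamP q_in q_out.
pose beta (t : nat) : R := ln (t%:R : R) / Gamma J h q.
pose pi t := sca_equilibrium J h q (beta t).
have beta_nd s t : (1 <= s)%N -> (s <= t)%N -> beta s <= beta t.
  move=> s1 st; rewrite ler_pM2r ?invr_gt0// ler_ln ?posrE ?ltr0n ?ler_nat//.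
  exact: leq_trans st.
have P_dist t s : is_distribution (P t s) := sca_trans_distribution _ _ _ _ _.
(* The schedule is chosen so that [expR (beta t * Gamma)] is exactly [t]. *)
have P_ge t s r : (1 <= t)%N -> (#|{: config V}|%:R * t%:R)^-1 <= P t s r.
  move=> t1; have beta_ge0 : 0 <= beta t by rewrite divr_ge0 ?ln_ge0 ?ler1n// ltW.
  have := sca_trans_ge J h q_ge0 s r beta_ge0.
  by rewrite /beta divfK ?gt_eqF// lnK// posrE ltr0n.
have config_neq0 : (#|{: config V}|%:R : R) != 0.
  by rewrite pnatr_eq0 -lt0n; apply/card_gt0P; exists [ffun=> true].
split.
  apply: nneseries_ge_harmonic => t => [|t1].
    (* Nonnegativity of the terms is the Doeblin bound with constant 0. *)
    have P_ge0 s r : 0 <= P t s r by case: (P_dist t s).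
    by have := dobrushin_le (P_dist t) P_ge0; rewrite mulr0 subr0 subr_ge0; exact.
  have inv_t : #|{: config V}|%:R * (#|{: config V}|%:R * t%:R)^-1 = t%:R^-1 :> R.
    by rewrite invfM mulrA divff// mul1r.
  rewrite lerBrDl addrC -lerBrDl -inv_t; apply: dobrushin_le => //.
    by move=> s r; exact: P_ge.
  by rewrite inv_t invf_le1 ?ltr0n// ler1n.
move=> j j1; apply: ereal_cvg0 => [t|e e_gt0].
  (* The supremum is nonnegative since it ranges over a nonempty set; [pi 0] is just some
     distribution. *)
  apply: (@le_trans _ _ (tv_dist (dist_evolve P (pi 0%N) j t) (pi_ground J h))%:E).
    by rewrite lee_fin tv_dist_ge0.
  apply: ereal_sup_ubound; exists (pi 0%N) => //.
  exact: sca_equilibrium_distribution.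
have beta_y : beta t @[t --> \oo] --> +oo := ln_div_cvgy Gamma_gt0.
have KZ_cvg : K * Z (beta t) @[t --> \oo] -->
    K * \sum_s zero_gaps (gap J h q) s.
  apply: cvgM; first exact: cvg_cst.
  by apply: gap_partition_cvg => //; exact: gap_ge0 lamP q_in q_out.
(* Error budget: one quarter for [N / t], one for the distance of [pi t] to the limit, and two for
   the variation of the equilibria after [N], as [K * Z] is within a quarter of its limit at both
   ends. *)
have e4_gt0 : 0 < e / 4 by rewrite divr_gt0.
have /cvgrPdist_le/(_ _ e4_gt0) KZ_near := KZ_cvg.
(* [N] is fixed before [t] and independently of [mu], so the final bound is uniform in the initial
   distribution. *)
have [N [jN KZ_N]] : exists N, (j <= N)%N /\
    `|K * \sum_s zero_gaps (gap J h q) s - K * Z (beta N)| <= e / 4.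
  have [M _ KZ_M] := KZ_near; exists (maxn j M); split; first exact: leq_maxl.
  by apply: KZ_M; exact: leq_maxr.
have N1 : (1 <= N)%N := leq_trans j1 jN.
have /cvgrPdist_le/(_ _ e4_gt0) equil_near := equil_cvg _ beta_y.
near=> t; apply: ge_ereal_sup => _ [mu mu_dist <-]; rewrite lee_fin.
have Nt : (N <= t)%N by near: t; exact: nbhs_infty_ge.
apply: le_trans (tv_dist_triangle _ (pi t) _) _.
have evolve_le := tv_dist_evolve P_dist P_ge
  (fun k => sca_equilibrium_distribution J h q (beta k))
  (fun k => sca_stationary h q J_sym (beta k)) mu_dist N1 jN Nt.
have sum_le : \sum_(N <= k < t) tv_dist (pi k.+1) (pi k) <=
    K * Z (beta N) - K * Z (beta t).
  rewrite -[leRHS]opprB -(telescope_sumr (fun k => K * Z (beta k)) Nt) -sumrN.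
  apply: ler_sum_nat => k /andP[Nk _]; rewrite opprB -mulrBr.
  by apply/variation/beta_nd => //; exact: leq_trans Nk.
(* The starting error is forgotten: [N] is fixed while [t] grows. *)
have ratio_le : N%:R / t%:R <= e / 4.
  have t_gt0 : (0 : R) < t%:R by rewrite ltr0n (leq_trans N1).
  rewrite ler_pdivrMr// mulrC -ler_pdivrMr//.
  by near: t; exact: nbhs_infty_ger.
have equil_le : tv_dist (pi t) (pi_ground J h) <= e / 4.
  rewrite -[leLHS]ger0_norm ?tv_dist_ge0// -normrN -sub0r.
  by near: t; exact: equil_near.
have KZ_t : `|K * \sum_s zero_gaps (gap J h q) s - K * Z (beta t)| <= e / 4.
  by near: t; exact: KZ_near.
move: KZ_N KZ_t; rewrite !ler_norml => /andP[? ?] /andP[? ?]; lra.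
Unshelve. all: by end_near.
Qed.
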